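(* Let $p$ be an odd prime, $m$ an even positive integer, $\mathbb{M}=\mathbb{F}_{p^m}$ and $\mathbb{L}=\mathbb{F}_{p^{m/2}}\subset\mathbb{M}$. Let $1\le k\le m-1$ be such that $m/\gcd(k,m)$ is odd, and put $q=p^k$, $r=p^{k+m/2}$. Let $a\in\mathbb{L}^\times$ and let $B\in\mathbb{M}^\times$ be a non-square in $\mathbb{M}$. Then the mapping $F:\mathbb{M}\times\mathbb{M}\to\mathbb{M}\times\mathbb{M}$, $$F(x,y)=\Bigl(x^{q+1}+B\,y^{q+1},\ \ x^{r}y+\tfrac{a}{B}\,x\,y^{r}\Bigr),$$ is planar.
   Context: For such a mapping $F$ the polarization is $\Delta_F(X,U)=F(X+U)-F(X)-F(U)$ for $X,U\in\mathbb{M}\times\mathbb{M}$; it is symmetric and $\mathbb{F}_p$-bilinear. $F$ is called planar if for every $U\in(\mathbb{M}\times\mathbb{M})\setminus\{(0,0)\}$ the equation $\Delta_F(X,U)=(0,0)$ has only the solution $X=(0,0)$; equivalently, $\Delta_F$ is the multiplication of a commutative pre-semifield on $\mathbb{M}\times\mathbb{M}$. *)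

(* Defs.v *)
From HB Require Import structures.
From mathcomp Require Import all_boot all_order all_algebra.

Set Implicit Arguments.
Unset Strict Implicit.
Unset Printing Implicit Defensive.

Import GRing.Theory.
Local Open Scope ring_scope.

Definition polarization (M : zmodType) (F : M * M -> M * M) (X U : M * M) :
    M * M :=
  F (X + U) - F X - F U.

(* This notion is meant for maps F whose polarization is biadditive (such as
   Dembowski-Ostrom maps); for an arbitrary F, planarity would instead ask
   that each X |-> F (X + U) - F X with U nonzero be a bijection. *)
Definition planar (M : zmodType) (F : M * M -> M * M) : Prop :=
  forall U : M * M, U != (0, 0) ->
  forall X : M * M, polarization F X U = (0, 0) <-> X = (0, 0).

Definition is_square (M : fieldType) (b : M) : Prop :=
  exists c : M, b = c ^+ 2.

Definition Fmap (M : fieldType) (q r : nat) (a B : M) (X : M * M) : M * M :=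
  let: (x, y) := X in
  (x ^+ q.+1 + B * y ^+ q.+1, x ^+ r * y + a / B * (x * y ^+ r)).

(* Main.v *)
Require Import Defs.
From HB Require Import structures.
From mathcomp Require Import all_boot all_order all_algebra.
From mathcomp Require Import all_fingroup all_solvable all_field ring.

Import GRing.Theory.
Local Open Scope ring_scope.

(** Write n for the square root of the order of M, x~ = x ^+ n for the
    conjugate of x over the subfield L of order n, and s for the map
    x |-> x ^+ q, so that x ^+ r = s (x~).  The idea is to show that if the
    polarization had a nontrivial zero, then B would be a square.  Two sources
    of squares are used: every element fixed by conjugation, in particular a,
    -1 and every norm x * x~, is a square in the quadratic extension M
    ([conj_fixed_is_square]), and so is every (q + 1)-th power.

    Suppose that the polarization at U = (u, v) vanishes at X = (x, y).  When
    u and v are nonzero, put x = u * z and y = v * w~, and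
      A = s z + z,   D = s w + w,   C = s z + w,   G = z + s w.
    The two equations become
      u ^ (q + 1) * A = - B * v ^ (q + 1) * D~,
      u ^ r * v * C~ = - (a / B) * u * v ^ r * G.
    Multiplying them eliminates B and gives mu * (A * D) = nu * (C * G), where
    mu and nu are fixed by conjugation.  On the other hand
      C * G - A * D = (z - w) ^ (q + 1),
    so (mu - nu) * (A * D) = nu * (z - w) ^ (q + 1), which forces A * D to be a
    square ([core_product_square]); if mu = nu, it does so because z = w and
    A = D.  But the first equation times D says that - B times a norm is
    A * D up to (q + 1)-th powers, so a nonzero D would make B a square.  Hence
    D = 0 and A = 0, and since s has odd order as an automorphism, s z = - z
    forces z = 0 ([frobenius_opp_eq0]); likewise w = 0.

    When u or v is zero, the first equation forces x = 0 or y = 0, and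
    the second one then expresses B as - a times an (r - 1)-th power, a
    square again ([mixed_term_eq0]). *)

(** * Squares in a field *)

Lemma is_squareM (M : fieldType) (x y : M) :
  is_square x -> is_square y -> is_square (x * y).
Proof. by move=> [c ->] [d ->]; exists (c * d); rewrite exprMn. Qed.

Lemma is_squareV (M : fieldType) (x : M) : is_square x -> is_square x^-1.
Proof. by move=> [c ->]; exists c^-1; rewrite exprVn. Qed.

Lemma is_square_expS (M : fieldType) (x : M) (q : nat) :
  odd q -> is_square (x ^+ q.+1).
Proof.
move=> q_odd; exists (x ^+ (q.+1)./2).
by rewrite -exprM muln2 even_halfK //= q_odd.
Qed.

(** * Conjugation over the subfield of index two *)

(** Multiplication by a nonzero element permutes the nonzero elements of the
    subfield, so it does not change their product. *)
Lemma subfield_expf_card {M : finFieldType} {L : {set M}} {a : M} :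
  divring_closed L -> a \in L -> a != 0 -> a ^+ #|L| = a.
Proof.
case=> L1 LB LV aL a0.
have L0 : 0 \in L by rewrite -(subrr 1) LB.
have LM x y : x \in L -> y \in L -> x * y \in L.
  by move=> xL yL; rewrite -[y]invrK LV // -[y^-1]mul1r LV.
have memM x : (a * x \in L :\ 0) = (x \in L :\ 0).
  rewrite !in_setD1 mulf_eq0 (negPf a0) /=; congr (_ && _).
  apply/idP/idP => [axL|]; last exact: LM.
  by rewrite -(mulKf a0 x) mulrC LV.
have E : \prod_(x in L :\ 0) x = a ^+ #|L :\ 0| * \prod_(x in L :\ 0) x.
  rewrite {1}(reindex_inj (mulfI a0)) /= (eq_bigl _ _ memM).
  by rewrite big_split /= prodr_const.
have P0 : \prod_(x in L :\ 0) x != 0.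
  by apply/prodf_neq0 => x; rewrite in_setD1 => /andP[].
rewrite (cardsD1 0 L) L0 add1n exprS.
by rewrite -(mulIf P0 (etrans (mul1r _) E)) mulr1.
Qed.

(** A nonzero fixed point x has x ^+ (n - 1) = 1.  In terms of a generator g of
    the cyclic group of order (n - 1) * (n + 1), the exponent of x is thus a
    multiple of n + 1, which is even. *)
Lemma conj_fixed_is_square (M : finFieldType) (n : nat) (x : M) :
  odd n -> #|M| = (n ^ 2)%N -> x ^+ n = x -> is_square x.
Proof.
case: n => // n n_odd cardM xn.
have [->|x0] := eqVneq x 0; first by exists 0; rewrite expr0n.
have /cyclicP[g Eg] := field_unit_group_cyclic [set: {unit M}]%G.
have ordg : #[g]%g = (n * n.+2)%N.
  rewrite orderE -Eg card_finField_unit cardM.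
  by rewrite -subn1 -[X in (_ - X)%N](exp1n 2) subn_sqr subn1 addn1.
have xU : x \is a GRing.unit by rewrite unitfE.
have [i Ei] : exists i, FinRing.unit M xU = (g ^+ i)%g.
  by apply/cycleP; rewrite -Eg inE.
have Ex : x = val g ^+ i by rewrite -FinRing.val_unitX -Ei.
have n_gt0 : (0 < n)%N.
  case: n {n_odd ordg} cardM xn => // cardM _.
  by have := finNzRing_gt1 M; rewrite cardM.
have gi1 : (g ^+ (i * n))%g = 1%g.
  apply: val_inj; rewrite /= FinRing.val_unitX exprM -Ex.
  by apply: (mulfI x0); rewrite -exprS mulr1.
have := order_dvdn g (i * n); rewrite gi1 eqxx ordg mulnC dvdn_pmul2r //.
move=> /dvdnP[j Ej]; exists (val g ^+ (j * n.+2./2)).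
rewrite Ex Ej -exprM -mulnA muln2 even_halfK //=.
by rewrite negbK; move: n_odd => /=.
Qed.

Lemma norm_fixed (M : finFieldType) (n : nat) (x : M) :
  #|M| = (n ^ 2)%N -> (x * x ^+ n) ^+ n = x * x ^+ n.
Proof.
by move=> cardM; rewrite exprMn -exprM mulnn -cardM expf_card mulrC.
Qed.

(** * The Frobenius map of odd order *)

(** Iterating z ^+ p ^ k = - z the odd number m / gcd(k, m) of times gives - z,
    but that iterate is a power of the trivial automorphism x |-> x ^+ p ^ m. *)
Lemma frobenius_opp_eq0 (M : finFieldType) (p m k : nat) (z : M) :
  odd p -> p \in [pchar M] -> #|M| = (p ^ m)%N -> odd (m %/ gcdn k m) ->
  z ^+ (p ^ k) + z = 0 -> z = 0.
Proof.
move=> p_odd pM cardM j_odd /eqP; rewrite addr_eq0 => /eqP zk.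
have iter_conj j : z ^+ (p ^ (k * j)) = (-1) ^+ j * z.
  elim: j => [|j IHj]; first by rewrite muln0 expn0 mul1r.
  rewrite mulnSr expnD exprM IHj exprMn zk -exprM mulnC exprM.
  by rewrite -(signr_odd _ (p ^ k)) oddX p_odd orbT expr1 exprSr mulrN mulrN1 mulNr.
have fix_iter i : z ^+ (p ^ (m * i)) = z.
  by elim: i => [|i IHi]; rewrite ?muln0 // mulnSr expnD exprM IHi -cardM expf_card.
have := iter_conj (m %/ gcdn k m)%N.
rewrite muln_divCA_gcd fix_iter -signr_odd j_odd expr1 mulN1r => /eqP.
rewrite -addr_eq0 -mulr2n -mulr_natr mulf_eq0 => /orP[/eqP //|].
rewrite -(dvdn_pcharf pM) => p2.
have p_prime := pcharf_prime pM.
by move: p2 p_odd; rewrite dvdn_prime2 // => /eqP ->.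
Qed.

(** * The polarization *)

(** A nontrivial zero would give B = - a * (t / s) ^+ (r - 1), a product of
    squares. *)
Lemma mixed_term_eq0 (M : fieldType) (r : nat) (a B s t : M) :
  odd r -> is_square (- a) -> B != 0 -> ~ is_square B ->
  s ^+ r * t + a / B * (s * t ^+ r) = 0 -> s = 0 \/ t = 0.
Proof.
move=> r_odd sq_a B0 nsqB E.
have [->|s0] := eqVneq s 0; [by left | right].
have [//|t0] := eqVneq t 0.
case: nsqB.
(* (t / s) ^ (r - 1) as a (r + 1)-th power over a square avoids r.-1 *)
have -> : B = - a * (t ^+ r.+1 * (s ^+ r.+1)^-1 * ((t / s) ^+ 2)^-1).
  have sr0 : s ^+ r != 0 by rewrite expf_eq0 (negPf s0) andbF.
  have E' : B * (s ^+ r * t) = - a * (s * t ^+ r).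
    apply/eqP; rewrite -subr_eq0 mulNr opprK; apply/eqP.
    by rewrite -[RHS](mulr0 B) -E; field.
  apply: (mulIf (mulf_neq0 sr0 t0)); rewrite E' !exprS.
  by field; rewrite t0 s0 sr0.
apply: is_squareM => //; apply: is_squareM; last first.
  by apply: is_squareV; exists (t / s).
by apply: is_squareM; [|apply: is_squareV]; exact: is_square_expS.
Qed.

(** The two products differ by (z - w) ^ (q + 1), so two conjugation-fixed
    multiples of them can agree only if (mu - nu) * (A * D) is
    nu * (z - w) ^ (q + 1), where A and D are the factors on the left; when
    mu = nu this forces z = w, hence A = D. *)
Lemma core_product_square (M : finFieldType) (n q : nat) (mu nu z w : M) :
  odd n -> #|M| = (n ^ 2)%N -> odd q ->
  [pchar M].-nat n -> [pchar M].-nat q ->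
  mu ^+ n = mu -> nu ^+ n = nu -> nu != 0 ->
  mu * ((z ^+ q + z) * (w ^+ q + w)) = nu * ((z ^+ q + w) * (z + w ^+ q)) ->
  is_square ((z ^+ q + z) * (w ^+ q + w)).
Proof.
move=> n_odd cardM q_odd n_char q_char mun nun nu0 E.
have subX k x y : odd k -> [pchar M].-nat k ->
    (x - y) ^+ k = x ^+ k - y ^+ k :> M.
  move=> k_odd k_char; rewrite exprDn_pchar // exprNn.
  by rewrite -signr_odd k_odd mulN1r.
have {}E : (mu - nu) * ((z ^+ q + z) * (w ^+ q + w)) = nu * (z - w) ^+ q.+1.
  by rewrite mulrBl E exprS subX //; ring.
have [Emu|neq_mu] := eqVneq mu nu.
  move/esym/eqP: E; rewrite Emu subrr mul0r mulf_eq0 (negPf nu0) /=.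
  rewrite expf_eq0 /= subr_eq0 => /eqP ->.
  by exists (w ^+ q + w); rewrite expr2.
have d0 : mu - nu != 0 by rewrite subr_eq0.
rewrite -(mulKf d0 (_ * _)) E.
apply: is_squareM; last apply: is_squareM; last exact: is_square_expS.
  by apply: (@conj_fixed_is_square _ n) => //; rewrite exprVn subX // mun nun.
exact: (@conj_fixed_is_square _ n).
Qed.

(** The hypotheses are the two components of the polarization at
    X = (u * z, v * w ^+ n) and U = (u, v).  Scaling by u and v isolates the
    powers whose square class is known, and conjugating w makes the products
    A * D and C * G symmetric in z and w.  If D were nonzero, the first
    equation times D would write B as a product of squares. *)
Lemma generic_zero (M : finFieldType) (n q : nat) (a B u v z w : M) :
  odd n -> #|M| = (n ^ 2)%N -> odd q ->
  [pchar M].-nat n -> [pchar M].-nat q ->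
  a ^+ n = a -> a != 0 -> B != 0 -> ~ is_square B -> u != 0 -> v != 0 ->
  u ^+ q.+1 * (z ^+ q + z) + B * (v ^+ q.+1 * (w ^+ q + w) ^+ n) = 0 ->
  u ^+ (q * n) * v * (z ^+ q + w) ^+ n +
    a / B * (u * v ^+ (q * n) * (z + w ^+ q)) = 0 ->
  z ^+ q + z = 0 /\ w ^+ q + w = 0.
Proof.
move=> n_odd cardM q_odd n_char q_char an a0 B0 nsqB u0 v0.
set A := z ^+ q + z; set D := w ^+ q + w.
set C := z ^+ q + w; set G := z + w ^+ q.
move=> E1 E2.
have uq0 : u ^+ q.+1 != 0 by rewrite expf_neq0.
have [D0|D0] := eqVneq D 0.
  split=> //; move/eqP: E1; rewrite D0 expr0n.
  have /negPf -> : n != 0%N by case: (n) n_odd.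
  by rewrite !mulr0 addr0 mulf_eq0 (negPf uq0) => /eqP.
have Dn0 : D ^+ n != 0 by rewrite expf_neq0.
have vq0 : v ^+ q != 0 by rewrite expf_neq0.
have vqn0 : v ^+ (q * n) != 0 by rewrite expf_neq0.
case: nsqB.
pose mu := (u ^+ q * (u ^+ q) ^+ n) * (C * C ^+ n).
pose nu := a * (v ^+ q * (v ^+ q) ^+ n) * (D * D ^+ n).
have mun : mu ^+ n = mu by rewrite exprMn !norm_fixed.
have nun : nu ^+ n = nu by rewrite exprMn norm_fixed // exprMn norm_fixed // an.
have nu0 : nu != 0 by rewrite /nu -exprM !mulf_neq0.
have {}E1 : u ^+ q.+1 * A = - (B * (v ^+ q.+1 * D ^+ n)).
  by apply/eqP; rewrite -addr_eq0 E1.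
have {}E2 : u ^+ (q * n) * v * C ^+ n =
    - (a / B * (u * v ^+ (q * n) * G)).
  by apply/eqP; rewrite -addr_eq0 E2.
(* the product of the two equations, in which B cancels *)
have E : mu * (A * D) = nu * (C * G).
  apply: (mulfI (mulf_neq0 u0 v0)); rewrite /mu /nu -!exprM.
  transitivity ((u ^+ q.+1 * A) * (u ^+ (q * n) * v * C ^+ n) * (C * D)).
    by rewrite exprS; ring.
  by rewrite E1 E2 exprS; field.
have sqAD : is_square (A * D).
  exact: (@core_product_square M n q mu nu z w).
have -> : B = -1 * (u ^+ q.+1 * (A * D) / (v ^+ q.+1 * (D * D ^+ n))).
  by rewrite mulrA E1 exprS; field; rewrite v0 vq0 D0 Dn0.
have sqfix (x : M) : x ^+ n = x -> is_square x.
  exact: conj_fixed_is_square.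
apply: is_squareM; first by apply: sqfix; rewrite -signr_odd n_odd.
apply: is_squareM.
  by apply: is_squareM => //; exact: is_square_expS.
apply: is_squareV; apply: is_squareM; first exact: is_square_expS.
by apply: sqfix; exact: norm_fixed.
Qed.

Lemma polarization_Fmap (M : fieldType) (q r : nat) (a B x y u v : M) :
  [pchar M].-nat q -> [pchar M].-nat r ->
  polarization (Fmap q r a B) (x, y) (u, v) =
    (x ^+ q * u + u ^+ q * x + B * (y ^+ q * v + v ^+ q * y),
     (x ^+ r * v + a / B * (x * v ^+ r)) +
     (u ^+ r * y + a / B * (u * y ^+ r))).
Proof.
move=> q_char r_char; rewrite /polarization /Fmap /=.
by congr pair; rewrite /= ?exprS !exprDn_pchar //; ring.
Qed.

Theorem theorem4p4 (p m k : nat) (M : finFieldType) (L : {set M}) (a B : M)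
    (p_prime : prime p) (p_odd : odd p)
    (m_gt0 : (0 < m)%N) (m_even : ~~ odd m)
    (cardM : #|M| = (p ^ m)%N)
    (L_subfield : divring_closed L) (cardL : #|L| = (p ^ (m %/ 2))%N)
    (k_bounds : (1 <= k <= m - 1)%N)
    (m_gcd_odd : odd (m %/ gcdn k m))
    (aL : a \in L) (a_neq0 : a != 0)
    (B_neq0 : B != 0) (B_nonsquare : ~ is_square B) :
  planar (Fmap (p ^ k) (p ^ (k + m %/ 2)) a B).
Proof.
have pM : p \in [pchar M] := card_finPcharP cardM p_prime.
have p_char j : [pchar M].-nat (p ^ j)%N by rewrite pnatX pnatE // pM.
have podd j : odd (p ^ j) by rewrite oddX p_odd orbT.
have cardM2 : #|M| = ((p ^ (m %/ 2)) ^ 2)%N.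
  by rewrite cardM -expnM divn2 muln2 even_halfK.
have an : a ^+ (p ^ (m %/ 2)) = a.
  by rewrite -cardL subfield_expf_card.
have sqNa : is_square (- a).
  apply: (@conj_fixed_is_square _ (p ^ (m %/ 2))) => //.
  by rewrite exprNn an -signr_odd podd mulN1r.
have frob (z : M) : z ^+ (p ^ k) + z = 0 -> z = 0.
  exact: (@frobenius_opp_eq0 M p m k).
move=> [u v] U0 [x y]; rewrite polarization_Fmap // expnD.
have exp00 j : 0 ^+ (p ^ j) = 0 :> M.
  by rewrite expr0n expn_eq0 -leqn0 leqNgt prime_gt0.
have exp00r : 0 ^+ (p ^ k * p ^ (m %/ 2)) = 0 :> M by rewrite -expnD.
have r_odd : odd (p ^ k * p ^ (m %/ 2)) by rewrite -expnD.
(* division by s ^ (q + 1) turns this into the equation of frob for t / s;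
   it is what remains of the first component when u = 0 or v = 0 *)
have diag0 (s t : M) : s != 0 ->
    t ^+ (p ^ k) * s + s ^+ (p ^ k) * t = 0 -> t = 0.
  move=> s0 E; have sq0 : s ^+ (p ^ k) != 0 by rewrite expf_neq0.
  have /frob/eqP : (t / s) ^+ (p ^ k) + t / s = 0.
    apply: (mulIf (mulf_neq0 s0 sq0)); rewrite mul0r -E exprMn exprVn.
    by field; rewrite s0 sq0.
  by rewrite mulf_eq0 invr_eq0 (negPf s0) orbF => /eqP.
split; last by case=> -> ->; rewrite exp00 exp00r !(mulr0, mul0r, addr0).
case=> E1 E2.
have [v0|v0] := eqVneq v 0.
  have u0 : u != 0 by apply: contraNneq U0 => ->; rewrite v0.
  rewrite v0 exp00 !(mulr0, mul0r, addr0) in E1.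
  have x0 := diag0 _ _ u0 E1.
  rewrite v0 x0 exp00r !(mulr0, mul0r, add0r) in E2.
  have [u1|->] := mixed_term_eq0 _ _ _ _ _ _ r_odd sqNa B_neq0 B_nonsquare E2.
    by rewrite u1 eqxx in u0.
  by rewrite x0.
have [u0|u0] := eqVneq u 0.
  rewrite u0 exp00 !(mulr0, mul0r, add0r) in E1.
  move/eqP: E1; rewrite mulf_eq0 (negPf B_neq0) /= => /eqP/(diag0 _ _ v0) y0.
  rewrite u0 y0 exp00r !(mulr0, mul0r, addr0) in E2.
  have [->|v1] := mixed_term_eq0 _ _ _ _ _ _ r_odd sqNa B_neq0 B_nonsquare E2.
    by rewrite y0.
  by rewrite v1 eqxx in v0.
pose z := x / u; pose w := (y / v) ^+ (p ^ (m %/ 2)).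
have Ex : x = u * z by rewrite /z mulrC divfK.
have conj2 (t : M) : (t ^+ (p ^ (m %/ 2))) ^+ (p ^ (m %/ 2)) = t.
  by rewrite -exprM mulnn -cardM2 expf_card.
have Ey : y = v * w ^+ (p ^ (m %/ 2)) by rewrite /w conj2 mulrC divfK.
clearbody z w.
have [Az Dw] : z ^+ (p ^ k) + z = 0 /\ w ^+ (p ^ k) + w = 0.
  apply: (@generic_zero M (p ^ (m %/ 2)) (p ^ k) a B u v) => //.
    rewrite -[RHS]E1 Ex Ey !exprS !exprDn_pchar // !exprMn.
    by rewrite [in RHS]exprAC; ring.
  rewrite -[RHS]E2 Ex Ey !exprDn_pchar // !exprMn.
  have -> : (w ^+ (p ^ (m %/ 2))) ^+ (p ^ k * p ^ (m %/ 2)) = w ^+ (p ^ k).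
    by rewrite mulnC exprM conj2.
  by rewrite (exprM z); ring.
by rewrite Ex Ey (frob z Az) (frob w Dw) exp00 !mulr0.
Qed.
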